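(* A De Morgan function lies in (i) $\langle \mathsf{DLat}, -, \partial\rangle$ if and only if it is harmonious; (ii) $\langle \mathsf{DLat}, \partial\rangle$ if and only if it is harmonious and positive; (iii) $\langle \mathsf{DLat}, -\rangle$ if and only if it is harmonious and persistent; (iv) $\langle \mathsf{DLat}, -, \Box\rangle$ if and only if it is harmonious and preserves $\mathrm{B}_2$, $\mathrm{K}_3$ and $\mathrm{P}_3$; (v) $\langle \mathsf{DLat}, \Box, \Diamond\rangle$ if and only if it is harmonious, positive, and preserves $\mathrm{B}_2$, $\mathrm{K}_3$ and $\mathrm{P}_3$.
   Context: Let $\mathrm{DM}_4=\{\mathsf t,\mathsf f,\mathsf n,\mathsf b\}$. The truth order $\le$ on $\mathrm{DM}_4$ has $\mathsf f$ as least element, $\mathsf t$ as greatest element, and $\mathsf n,\mathsf b$ incomparable; $\wedge,\vee$ denote its meet and join. The information order $\sqsubseteq$ has $\mathsf n$ least, $\mathsf b$ greatest, and $\mathsf t,\mathsf f$ incomparable. De Morgan negation: $-\mathsf t=\mathsf f$, $-\mathsf f=\mathsf t$, $-\mathsf n=\mathsf n$, $-\mathsf b=\mathsf b$. Conflation: $\partial\mathsf t=\mathsf t$, $\partial\mathsf f=\mathsf f$, $\partial\mathsf n=\mathsf b$, $\partial\mathsf b=\mathsf n$. $\Box a=\mathsf t$ if $a=\mathsf t$ and $\Box a=\mathsf f$ otherwise; $\Diamond a=\mathsf f$ if $a=\mathsf f$ and $\Diamond a=\mathsf t$ otherwise. A De Morgan function is a map $\mathrm{DM}_4^n\to\mathrm{DM}_4$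 with $n\ge 1$; a clone is a set of such functions closed under composition and containing all projections; constants are treated as unary constant functions. $\langle X\rangle$ is the clone generated by $X$, and $\langle \mathsf C, f_1,\dots,f_k\rangle$ is the clone generated by $\mathsf C\cup\{f_1,\dots,f_k\}$. $\mathsf{DLat}=\langle \wedge,\vee,\mathsf t,\mathsf f\rangle$. Operations on tuples are applied componentwise and orders on tuples are componentwise. A De Morgan function $f$ is harmonious if $f(\partial\overline a)=\partial f(\overline a)$ for all $\overline a$; positive if $\overline a\le\overline b$ implies $f(\overline a)\le f(\overline b)$; persistent if $\overline a\sqsubseteq\overline b$ implies $f(\overline a)\sqsubseteq f(\overline b)$. $f$ preserves $X\subseteq\mathrm{DM}_4$ if all arguments in $X$ give a value in $X$. $\mathrm{B}_2=\{\mathsf t,\mathsf f\}$, $\mathrm{K}_3=\{\mathsf t,\mathsf n,\mathsf f\}$, $\mathrm{P}_3=\{\mathsf t,\mathsf b,\mathsf f\}$. *)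

(* Defs.v *)
From HB Require Import structures.
From mathcomp Require Import all_boot all_order.
From mathcomp Require Import boolp classical_sets.

Set Implicit Arguments.
Unset Strict Implicit.
Unset Printing Implicit Defensive.

Import Order.TTheory.
Local Open Scope order_scope.
Local Open Scope classical_set_scope.

Inductive DM4 : Set := dmT | dmF | dmN | dmB.

Definition DM4_code (x : DM4) : bool * bool :=
  match x with
  | dmT => (true, false) | dmF => (false, true)
  | dmN => (false, false) | dmB => (true, true)
  end.

Definition DM4_decode (p : bool * bool) : DM4 :=
  match p with
  | (true, false) => dmT | (false, true) => dmF
  | (false, false) => dmN | (true, true) => dmB
  end.

Lemma DM4_codeK : cancel DM4_code DM4_decode.
Proof. by case. Qed.

HB.instance Definition _ := Finite.copy DM4 (can_type DM4_codeK).

(* The library order on DM4, hence Order.meet and Order.join, is the truth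
   order; the information order is the separate relation info_le. *)
Definition truth_le : rel DM4 :=
  fun x y => [|| x == dmF, y == dmT | x == y].

Definition info_le : rel DM4 :=
  fun x y => [|| x == dmN, y == dmB | x == y].

Definition dm_and (x y : DM4) : DM4 :=
  if truth_le x y then x else if truth_le y x then y else dmF.

Definition dm_or (x y : DM4) : DM4 :=
  if truth_le x y then y else if truth_le y x then x else dmT.

Lemma truth_le_refl : reflexive truth_le.
Proof. by case. Qed.

Lemma truth_le_anti : antisymmetric truth_le.
Proof. by do 2!case. Qed.

Lemma truth_le_trans : transitive truth_le.
Proof. by do 3!case. Qed.

Fact truth_display : Order.disp_t. Proof. exact: Order.Disp tt tt. Qed.

HB.instance Definition _ := Order.Le_isPOrder.Build truth_display DM4
  truth_le_refl truth_le_anti truth_le_trans.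

Lemma dm_andP (x y z : DM4) : (x <= dm_and y z) = (x <= y) && (x <= z).
Proof. by case: x; case: y; case: z. Qed.

Lemma dm_orP (x y z : DM4) : (dm_or x y <= z) = (x <= z) && (y <= z).
Proof. by case: x; case: y; case: z. Qed.

HB.instance Definition _ := Order.POrder_MeetJoin_isLattice.Build
  truth_display DM4 dm_andP dm_orP.

Definition dm_neg (x : DM4) : DM4 :=
  match x with dmT => dmF | dmF => dmT | dmN => dmN | dmB => dmB end.

Definition dm_conf (x : DM4) : DM4 :=
  match x with dmT => dmT | dmF => dmF | dmN => dmB | dmB => dmN end.

Definition dm_box (x : DM4) : DM4 := if x == dmT then dmT else dmF.

Definition dm_dia (x : DM4) : DM4 := if x == dmF then dmF else dmT.

(* Arities are at least 1: DMfun n is the type of De Morgan functions of arity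
   n.+1.  With finfuns, Leibniz equality is equality of functions. *)
Definition DMfun (n : nat) := {ffun n.+1.-tuple DM4 -> DM4}.

(* De Morgan functions of arbitrary arity. *)
Definition DMop := {n : nat & DMfun n}.

Definition op (n : nat) (f : DMfun n) : DMop := Tagged DMfun f.

Definition dm_proj (n : nat) (i : 'I_n.+1) : DMfun n := [ffun a => tnth a i].

Definition dm_comp (k n : nat) (g : DMfun k) (h : 'I_k.+1 -> DMfun n) :
  DMfun n := [ffun a => g [tuple h i a | i < k.+1]].

Definition is_clone (C : set DMop) : Prop :=
  (forall (n : nat) (i : 'I_n.+1), C (op (dm_proj i))) /\
  (forall (k n : nat) (g : DMfun k) (h : 'I_k.+1 -> DMfun n),
     C (op g) -> (forall i, C (op (h i))) -> C (op (dm_comp g h))).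

Definition clone_gen (X : set DMop) : set DMop := smallest is_clone X.

Definition unary_op (u : DM4 -> DM4) : DMop :=
  @op 0 [ffun a => u (tnth a ord0)].

Definition binary_op (m : DM4 -> DM4 -> DM4) : DMop :=
  @op 1 [ffun a => m (tnth a ord0) (tnth a ord_max)].

Definition const_op (c : DM4) : DMop := unary_op (fun=> c).

Definition op_and : DMop := binary_op Order.meet.
Definition op_or : DMop := binary_op Order.join.
Definition op_neg : DMop := unary_op dm_neg.
Definition op_conf : DMop := unary_op dm_conf.
Definition op_box : DMop := unary_op dm_box.
Definition op_dia : DMop := unary_op dm_dia.

Definition DLat : set DMop :=
  clone_gen [set op_and; op_or; const_op dmT; const_op dmF].

Definition harmonious (n : nat) (f : DMfun n) : Prop :=
  forall a : n.+1.-tuple DM4, f (map_tuple dm_conf a) = dm_conf (f a).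

Definition positive (n : nat) (f : DMfun n) : Prop :=
  forall a b : n.+1.-tuple DM4,
    (forall i, tnth a i <= tnth b i) -> f a <= f b.

Definition persistent (n : nat) (f : DMfun n) : Prop :=
  forall a b : n.+1.-tuple DM4,
    (forall i, info_le (tnth a i) (tnth b i)) -> info_le (f a) (f b).

Definition preserves (n : nat) (f : DMfun n) (X : {set DM4}) : Prop :=
  forall a : n.+1.-tuple DM4, (forall i, tnth a i \in X) -> f a \in X.

Definition B2 : {set DM4} := [set dmT; dmF]%SET.
Definition K3 : {set DM4} := [set dmT; dmN; dmF]%SET.
Definition P3 : {set DM4} := [set dmT; dmB; dmF]%SET.

(* Main.v *)
Require Import Defs.
From mathcomp Require Import all_boot all_order.
From mathcomp Require Import boolp classical_sets.

Local Open Scope classical_set_scope.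

(** Read [DM4] as the square of the two-element lattice, conflation being the
    swap of the two coordinates.  A harmonious function is then determined by
    its first coordinate, that is, by the set of tuples at which its value lies
    in [{t, b}].  By disjunctive normal form, a clone of harmonious functions
    containing [DLat] contains a harmonious [f] as soon as any [p], [q] with
    [f p] in [{t, b}] and [f q] outside [{t, b}] are separated in this sense by
    some member of the clone.  The invariants of each clone say exactly that
    such separating members exist. *)

(** * Designated values: the first coordinate of the square representation *)

Definition designated (x : DM4) : bool := (x == dmT) || (x == dmB).

Lemma designated_meet (x y : DM4) :
  designated (Order.meet x y) = designated x && designated y.
Proof. by case: x; case: y. Qed.

Lemma designated_join (x y : DM4) :
  designated (Order.join x y) = designated x || designated y.
Proof. by case: x; case: y. Qed.

Lemma designated_le (x y : DM4) :
  (x <= y)%O -> designated x -> designated y.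
Proof. by case: x; case: y. Qed.

Lemma designated_info_le (x y : DM4) :
  info_le x y -> designated x -> designated y.
Proof. by case: x; case: y. Qed.

(** Conflation swaps the two coordinates, so [designated (dm_conf x)] is the second coordinate of
    [x]. *)
Lemma designated_inj (x y : DM4) :
  designated x = designated y ->
  designated (dm_conf x) = designated (dm_conf y) -> x = y.
Proof. by case: x; case: y. Qed.

(** By harmony, the second coordinate of [f a] is the first coordinate of [f] at the conflated
    tuple. *)
Lemma harmonious_designated_inj (n : nat) (f g : DMfun n) :
  harmonious f -> harmonious g ->
  (forall a, designated (f a) = designated (g a)) -> f = g.
Proof.
move=> hf hg fg; apply/ffunP => a; apply: designated_inj => //.
by rewrite -hf -hg.
Qed.

(** * Generated clones and closure under composition *)

Lemma clone_gen_is_clone (X : set DMop) : is_clone (clone_gen X).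
Proof.
split=> [n i C [[Cproj _] _]|k n g h Xg Xh C CX]; first exact: Cproj.
by have [[_ Ccomp] _] := CX; apply: Ccomp => [|i]; [apply: Xg|apply: Xh].
Qed.

Lemma sub_clone_gen (X : set DMop) : X `<=` clone_gen X.
Proof. by move=> f Xf C [_]; apply. Qed.

Lemma clone_gen_min (C X : set DMop) :
  is_clone C -> X `<=` C -> clone_gen X `<=` C.
Proof. by move=> Cclone XC f; apply. Qed.

Definition lattice_clone (C : set DMop) : Prop :=
  [/\ is_clone C, C op_and, C op_or, C (const_op dmT) & C (const_op dmF)].

Lemma lattice_clone_gen (U : set DMop) : lattice_clone (clone_gen (DLat `|` U)).
Proof.
by split; first exact: clone_gen_is_clone;
  apply: sub_clone_gen; left; apply: sub_clone_gen; rewrite /=; tauto.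
Qed.

(** This unfolds the nested generation: [DLat] is itself a generated clone, so it lies in [C] as
    soon as its four generators do. *)
Lemma clone_gen_lattice_min (C U : set DMop) :
  lattice_clone C -> U `<=` C -> clone_gen (DLat `|` U) `<=` C.
Proof.
move=> [Cclone Cand Cor Ct Cf] UC; apply: clone_gen_min => // g [|/UC//].
by apply: clone_gen_min => // _ [[[->|->]|->]|->].
Qed.

Lemma clone_binary (C : set DMop) (m : DM4 -> DM4 -> DM4) (n : nat)
    (g h : DMfun n) :
  is_clone C -> C (binary_op m) -> C (op g) -> C (op h) ->
  C (op ([ffun a => m (g a) (h a)] : DMfun n)).
Proof.
move=> [_ Ccomp] Cm Cg Ch.
pose gh (i : 'I_2) := if i == ord0 then g else h.
have -> : [ffun a => m (g a) (h a)] =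
    dm_comp ([ffun a => m (tnth a ord0) (tnth a ord_max)] : DMfun 1) gh.
  by apply/ffunP => a; rewrite !ffunE !tnth_mktuple.
by apply: Ccomp => // i; rewrite /gh; case: ifP.
Qed.

Lemma clone_unary (C : set DMop) (u : DM4 -> DM4) (n : nat) (g : DMfun n) :
  is_clone C -> C (unary_op u) -> C (op g) ->
  C (op ([ffun a => u (g a)] : DMfun n)).
Proof.
move=> [_ Ccomp] Cu Cg.
have -> : [ffun a => u (g a)] =
    dm_comp ([ffun a => u (tnth a ord0)] : DMfun 0) (fun=> g).
  by apply/ffunP => a; rewrite !ffunE tnth_mktuple.
exact: Ccomp.
Qed.

Lemma clone_id (C : set DMop) : is_clone C -> C (unary_op id).
Proof.
case=> Cproj _; suff -> : unary_op id = op (dm_proj (ord0 : 'I_1)) by [].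
by congr op; apply/ffunP => a; rewrite !ffunE.
Qed.

Lemma clone_unary_comp (C : set DMop) (u v : DM4 -> DM4) :
  is_clone C -> C (unary_op u) -> C (unary_op v) -> C (unary_op (u \o v)).
Proof.
move=> Cclone Cu Cv; have := @clone_unary C u 0 _ Cclone Cu Cv.
by congr (C (op _)); apply/ffunP => a; rewrite !ffunE.
Qed.

Lemma clone_const (C : set DMop) (c : DM4) (n : nat) :
  is_clone C -> C (const_op c) -> C (op ([ffun=> c] : DMfun n)).
Proof.
move=> Cclone Cc.
have := @clone_unary C (fun=> c) n (dm_proj ord0) Cclone Cc (Cclone.1 _ _).
by congr (C (op _)); apply/ffunP => a; rewrite !ffunE.
Qed.

(** * Invariant relations *)

(** One notion covers every invariant: harmony is preservation of the graph of conflation,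
    positivity and persistence are preservation of the two orders, and a subset is encoded by a
    relation that ignores its second argument. *)
Definition preserves_rel (r : rel DM4) (g : DMop) : Prop :=
  forall a b : (tag g).+1.-tuple DM4,
    (forall i, r (tnth a i) (tnth b i)) -> r (tagged g a) (tagged g b).

Lemma preserves_rel_clone (r : rel DM4) : is_clone (preserves_rel r).
Proof.
split=> [n i a b ab|k n g h rg rh a b ab]; first by rewrite /= !ffunE.
by rewrite /= !ffunE; apply: rg => i; rewrite !tnth_mktuple; apply: rh.
Qed.

Lemma preserves_rel_unary (r : rel DM4) (u : DM4 -> DM4) :
  (forall x y, r x y -> r (u x) (u y)) -> preserves_rel r (unary_op u).
Proof. by move=> ru a b ab; rewrite /= !ffunE; apply: ru. Qed.

Lemma preserves_rel_binary (r : rel DM4) (m : DM4 -> DM4 -> DM4) :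
  (forall x y x' y', r x y -> r x' y' -> r (m x x') (m y y')) ->
  preserves_rel r (binary_op m).
Proof. by move=> rm a b ab; rewrite /= !ffunE; apply: rm. Qed.

Definition conf_rel : rel DM4 := fun x y => y == dm_conf x.
Definition in_rel (X : {set DM4}) : rel DM4 := fun x _ => x \in X.

Lemma harmoniousE (n : nat) (f : DMfun n) :
  harmonious f <-> preserves_rel conf_rel (op f).
Proof.
split=> [hf a b ab|hf a].
  rewrite /conf_rel /= -hf; apply/eqP; congr (f _).
  by apply: eq_from_tnth => i; rewrite tnth_map; apply/eqP/ab.
by apply/eqP/hf => i; rewrite tnth_map /conf_rel.
Qed.

Lemma preservesE (n : nat) (f : DMfun n) (X : {set DM4}) :
  preserves f X <-> preserves_rel (in_rel X) (op f).
Proof. by split=> [fX a b|fX a]; [apply: fX|apply: (fX a a)]. Qed.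

Lemma preserves_rel_gen (r : rel DM4) (U : set DMop) (n : nat) (f : DMfun n) :
  (forall x y x' y', r x y -> r x' y' -> r (Order.meet x x') (Order.meet y y')) ->
  (forall x y x' y', r x y -> r x' y' -> r (Order.join x x') (Order.join y y')) ->
  r dmT dmT -> r dmF dmF -> U `<=` preserves_rel r ->
  clone_gen (DLat `|` U) (op f) -> preserves_rel r (op f).
Proof.
move=> rM rJ rt rf rU; apply: (clone_gen_lattice_min _ _ _ rU); split.
- exact: preserves_rel_clone.
- exact: preserves_rel_binary.
- exact: preserves_rel_binary.
- exact: preserves_rel_unary.
- exact: preserves_rel_unary.
Qed.

(** Conflation is an automorphism of the truth lattice fixing [dmT] and [dmF]. *)
Lemma harmonious_gen (U : set DMop) (n : nat) (f : DMfun n) :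
  U `<=` preserves_rel conf_rel ->
  clone_gen (DLat `|` U) (op f) -> harmonious f.
Proof.
move=> hU Uf; apply/harmoniousE; move: Uf.
by apply: preserves_rel_gen => //; do 4!case.
Qed.

Lemma positive_gen (U : set DMop) (n : nat) (f : DMfun n) :
  U `<=` preserves_rel <=%O ->
  clone_gen (DLat `|` U) (op f) -> positive f.
Proof. by apply: preserves_rel_gen => //; do 4!case. Qed.

(** Truth meet and join are also monotone in the information order. *)
Lemma persistent_gen (U : set DMop) (n : nat) (f : DMfun n) :
  U `<=` preserves_rel info_le ->
  clone_gen (DLat `|` U) (op f) -> persistent f.
Proof. by apply: preserves_rel_gen => //; do 4!case. Qed.

(** Each of the three sets is a sublattice containing [dmT] and [dmF]. *)
Lemma preserves_gen (U : set DMop) (n : nat) (f : DMfun n) (X : {set DM4}) :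
  X \in [:: B2; K3; P3] -> U `<=` preserves_rel (in_rel X) ->
  clone_gen (DLat `|` U) (op f) -> preserves f X.
Proof.
move=> BKP XU Uf; apply/preservesE; move: Uf; move: XU.
by move: BKP; rewrite !inE => /or3P[] /eqP-> XU; apply: preserves_rel_gen;
  rewrite // /in_rel ?inE // => x _ x' _; case: x; case: x'; rewrite !inE.
Qed.

(** * Separation *)

(** The relation is directed: [p] and [q] cannot be exchanged in general, since [C] need not contain
    negation. *)
Definition separated (C : set DMop) (n : nat) (p q : n.+1.-tuple DM4) : Prop :=
  exists2 g : DMfun n, C (op g) & designated (g p) && ~~ designated (g q).

Lemma separated_unary (C : set DMop) (n : nat) (p q : n.+1.-tuple DM4)
    (i : 'I_n.+1) :
  is_clone C ->
  (exists2 u, C (unary_op u) &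
     designated (u (tnth p i)) && ~~ designated (u (tnth q i))) ->
  separated C n p q.
Proof.
move=> Cclone [u Cu upq].
exists [ffun a => u (dm_proj i a)]; last by rewrite !ffunE.
exact: (clone_unary C u n (dm_proj i) Cclone Cu (Cclone.1 _ _)).
Qed.

Lemma clone_of_separated (C : set DMop) (n : nat) (f : DMfun n) :
  lattice_clone C ->
  (forall g : DMfun n, C (op g) -> harmonious g) -> harmonious f ->
  (forall p q, designated (f p) -> ~~ designated (f q) -> separated C n p q) ->
  C (op f).
Proof.
move=> [Cclone Cand Cor Ct Cf] Charm hf sep.
(* A conjunctive clause for [p]: the meet, starting from the constant [dmT], of members separating
   [p] from the bad tuples in [s]. *)
have conj p (s : seq (n.+1.-tuple DM4)) : designated (f p) ->
    exists g : DMfun n, [/\ C (op g), designated (g p) &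
      forall q, q \in s -> ~~ designated (f q) -> ~~ designated (g q)].
  move=> fp; elim: s => [|q s [g [Cg gp gs]]].
    by exists [ffun=> dmT]; split; [exact: clone_const|rewrite ffunE|].
  have [fq|fq] := boolP (designated (f q)).
    by exists g; split=> // q'; rewrite inE => /predU1P[->|/gs//]; rewrite fq.
  have [h Ch /andP[hp hq]] := sep p q fp fq.
  exists [ffun a => Order.meet (h a) (g a)]; split; first exact: clone_binary.
    by rewrite ffunE designated_meet hp gp.
  move=> q'; rewrite inE ffunE designated_meet negb_and.
  by case/predU1P=> [->|q's /(gs _ q's) ->]; rewrite ?hq ?orbT.
(* The join, starting from the constant [dmF], of the clauses of the tuples of [s] at which [f] is
   designated. *)
have disj (s : seq (n.+1.-tuple DM4)) : exists g : DMfun n, [/\ C (op g),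
    forall q, ~~ designated (f q) -> ~~ designated (g q) &
    forall p, p \in s -> designated (f p) -> designated (g p)].
  elim: s => [|p s [g [Cg gN gs]]].
    by exists [ffun=> dmF]; split=> [|q|//]; [exact: clone_const|rewrite ffunE].
  have [fp|fp] := boolP (designated (f p)); last first.
    exists g; split=> // p'; rewrite inE => /predU1P[->|/gs//].
    by rewrite (negbTE fp).
  have [h [Ch hp hN]] := conj p (enum {: n.+1.-tuple DM4}) fp.
  exists [ffun a => Order.join (h a) (g a)]; split; first exact: clone_binary.
    move=> q fq; rewrite ffunE designated_join negb_or gN // andbT.
    by apply: hN; rewrite ?mem_enum.
  move=> p'; rewrite inE ffunE designated_join.
  by case/predU1P=> [->|p's /(gs _ p's) ->]; rewrite ?hp ?orbT.
have [g [Cg gN gP]] := disj (enum {: n.+1.-tuple DM4}).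
(* The normal form [g] matches [f] only in the first coordinate; harmony of both upgrades this to
   equality. *)
rewrite (_ : f = g) //; apply: harmonious_designated_inj => // [|a].
  exact: Charm.
have [fa|fa] := boolP (designated (f a)); last by rewrite (negbTE (gN a fa)).
by rewrite gP // mem_enum.
Qed.

(* The functions [Dia (x /\ y)] and [Box (x \/ y)] tell equal from distinct
   pairs over [{n, b}], where no unary member of the clone separates [n]
   from [b]. *)
Lemma separated_box_dia (C : set DMop) (n : nat) (p q : n.+1.-tuple DM4)
    (i j : 'I_n.+1) :
  lattice_clone C -> C op_box -> C op_dia ->
  tnth p j = dmN -> tnth q j = dmB ->
  tnth p i = tnth q i -> tnth p i \in [:: dmN; dmB] -> separated C n p q.
Proof.
move=> [Cclone Cand Cor _ _] Cbox Cdia pj qj pqi.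
have Cm (m : DM4 -> DM4 -> DM4) (u : DM4 -> DM4) :
    C (binary_op m) -> C (unary_op u) ->
    C (op ([ffun a => u (m (tnth a i) (tnth a j))] : DMfun n)).
  move=> Cm Cu; have := clone_binary C m n (dm_proj i) (dm_proj j) Cclone Cm
    (Cclone.1 _ _) (Cclone.1 _ _).
  move/(clone_unary C u n _ Cclone Cu); congr (C (op _)).
  by apply/ffunP => a; rewrite !ffunE.
rewrite !inE => /orP[] /eqP pi.
  exists [ffun a => dm_dia (Order.meet (tnth a i) (tnth a j))]; first exact: Cm.
  by rewrite !ffunE -pqi pi pj qj.
exists [ffun a => dm_box (Order.join (tnth a i) (tnth a j))]; first exact: Cm.
by rewrite !ffunE -pqi pi pj qj.
Qed.

(** * Separating members obtained from the invariants of each clone *)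

Lemma designated_conf_K3 (n : nat) (f : DMfun n) (a : n.+1.-tuple DM4) :
  harmonious f -> preserves f K3 -> (forall i, tnth a i \in K3) ->
  designated (f a) -> designated (f (map_tuple dm_conf a)).
Proof. by move=> hf fK /fK; rewrite hf !inE; case: (f a). Qed.

(** The four unary maps used are designated exactly on {t, b}, {f, b}, {t, n} and {f, n}, which
    separate any two distinct values in either direction. *)
Lemma separated_harmonious (C : set DMop) (n : nat) (f : DMfun n) p q :
  is_clone C -> C op_neg -> C op_conf ->
  designated (f p) -> ~~ designated (f q) -> separated C n p q.
Proof.
move=> Cclone Cneg Cconf fp fq.
have [i pqi] : exists i, tnth p i != tnth q i.
  apply/existsP; apply: contraNT fq; rewrite negb_exists => /forallP pq.
  suff <- : p = q by [].
  by apply: eq_from_tnth => i; apply/eqP; rewrite -[_ == _]negbK.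
apply: (separated_unary _ _ _ _ i Cclone); have Cid := clone_id _ Cclone.
have Cnc : C (unary_op (dm_neg \o dm_conf)) by exact: clone_unary_comp.
by case: (tnth p i) (tnth q i) pqi => [] [] //= _; first
  [by exists id | by exists dm_neg | by exists dm_conf
  | by exists (dm_neg \o dm_conf)].
Qed.

(** Identity and conflation test membership in {t, b} and {t, n}, the prime filters of the truth
    order, which together detect any failure of that order. *)
Lemma separated_positive (C : set DMop) (n : nat) (f : DMfun n) p q :
  is_clone C -> C op_conf -> positive f ->
  designated (f p) -> ~~ designated (f q) -> separated C n p q.
Proof.
move=> Cclone Cconf fpos fp fq.
have [i pqi] : exists i, ~~ (tnth p i <= tnth q i)%O.
  apply/existsP; apply: contraNT fq; rewrite negb_exists => /forallP pq.
  by apply: designated_le fp; apply: fpos => i; rewrite -[(_ <= _)%O]negbK.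
apply: (separated_unary _ _ _ _ i Cclone); have Cid := clone_id _ Cclone.
by case: (tnth p i) (tnth q i) pqi => [] [] //= _; first
  [by exists id | by exists dm_conf].
Qed.

(** The same argument for the information order, whose prime filters {t, b} and {f, b} are tested by
    identity and negation. *)
Lemma separated_persistent (C : set DMop) (n : nat) (f : DMfun n) p q :
  is_clone C -> C op_neg -> persistent f ->
  designated (f p) -> ~~ designated (f q) -> separated C n p q.
Proof.
move=> Cclone Cneg fper fp fq.
have [i pqi] : exists i, ~~ info_le (tnth p i) (tnth q i).
  apply/existsP; apply: contraNT fq; rewrite negb_exists => /forallP pq.
  by apply: designated_info_le fp; apply: fper => i; rewrite -[info_le _ _]negbK.
apply: (separated_unary _ _ _ _ i Cclone); have Cid := clone_id _ Cclone.
by case: (tnth p i) (tnth q i) pqi => [] [] //= _; first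
  [by exists id | by exists dm_neg].
Qed.

(** Unary members separate every pair of distinct values except (n, b). If only such pairs occur,
    either a coordinate shared by [p] and [q] with value n or b allows a binary separation, or [q]
    is the conflation of a tuple [p] over [K3], where [f] cannot lose designation. *)
Lemma separated_neg_box (C : set DMop) (n : nat) (f : DMfun n) p q :
  lattice_clone C -> C op_neg -> C op_box -> harmonious f -> preserves f K3 ->
  designated (f p) -> ~~ designated (f q) -> separated C n p q.
Proof.
move=> Clat Cneg Cbox hf fK fp fq; have [Cclone _ _ _ _] := Clat.
have Cid := clone_id _ Cclone.
have Cnb : C (unary_op (dm_neg \o dm_box)) by exact: clone_unary_comp.
(* The diamond is the De Morgan dual of the box. *)
have Cdia : C op_dia.
  have := clone_unary_comp _ _ _ Cclone Cnb Cneg.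
  by congr (C (op _)); apply/ffunP => a; rewrite !ffunE /=; case: (tnth a _).
have Cnd : C (unary_op (dm_neg \o dm_dia)) by exact: clone_unary_comp.
have [/existsP[i pqi]|] := boolP [exists i,
    (tnth p i != tnth q i) && ((tnth p i, tnth q i) != (dmN, dmB))].
  apply: (separated_unary _ _ _ _ i Cclone).
  by case: (tnth p i) (tnth q i) pqi => [] [] //= _; first
    [by exists id | by exists dm_neg | by exists dm_box | by exists dm_dia
    | by exists (dm_neg \o dm_box) | by exists (dm_neg \o dm_dia)].
rewrite negb_exists => /forallP NB.
have [j pj qj] : exists2 j, tnth p j = dmN & tnth q j = dmB.
  have [/existsP[j]|] := boolP [exists j, tnth p j != tnth q j].
    move=> pqj; exists j; have := NB j; rewrite pqj /= negbK => /eqP.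
      by case.
    by case.
  rewrite negb_exists => /forallP pq; case/negP: fq.
  suff <- : p = q by [].
  by apply: eq_from_tnth => j; apply/eqP; rewrite -[_ == _]negbK.
have [/existsP[i /andP[/eqP pqi pi]]|] := boolP [exists i,
    (tnth p i == tnth q i) && (tnth p i \in [:: dmN; dmB])].
  exact: (separated_box_dia _ _ _ _ i j).
rewrite negb_exists => /forallP TF; case/negP: fq.
(* Every coordinate is now either the pair (n, b) or a common value t or f. *)
suff [pK <-] : (forall i, tnth p i \in K3) /\ map_tuple dm_conf p = q.
  exact: designated_conf_K3.
split=> [i|]; last (apply: eq_from_tnth => i; rewrite tnth_map).
all: by move: (NB i) (TF i); rewrite ?inE; case: (tnth p i) (tnth q i) => [] [].
Qed.

(** Without negation, unary members handle only failures of the truth order other than (n, b). In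
    the last case [f] stays designated along [p], [r], the conflation of [r], and [q]: positivity
    gives the outer two passages, [K3] the middle one. *)
Lemma separated_box_dia_positive (C : set DMop) (n : nat) (f : DMfun n) p q :
  lattice_clone C -> C op_box -> C op_dia ->
  harmonious f -> positive f -> preserves f K3 ->
  designated (f p) -> ~~ designated (f q) -> separated C n p q.
Proof.
move=> Clat Cbox Cdia hf fpos fK fp fq; have [Cclone _ _ _ _] := Clat.
have Cid := clone_id _ Cclone.
have [/existsP[i pqi]|] := boolP [exists i,
    ~~ (tnth p i <= tnth q i)%O && ((tnth p i, tnth q i) != (dmN, dmB))].
  apply: (separated_unary _ _ _ _ i Cclone).
  by case: (tnth p i) (tnth q i) pqi => [] [] //= _; first
    [by exists id | by exists dm_box | by exists dm_dia].
rewrite negb_exists => /forallP NB.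
have [j pj qj] : exists2 j, tnth p j = dmN & tnth q j = dmB.
  have [/existsP[j]|] := boolP [exists j, ~~ (tnth p j <= tnth q j)%O].
    move=> pqj; exists j; have := NB j; rewrite pqj /= negbK => /eqP.
      by case.
    by case.
  rewrite negb_exists => /forallP pq; case/negP: fq.
  by apply: designated_le fp; apply: fpos => j; rewrite -[(_ <= _)%O]negbK.
have [/existsP[i /andP[/eqP pqi pi]]|] := boolP [exists i,
    (tnth p i == tnth q i) && (tnth p i \in [:: dmN; dmB])].
  exact: (separated_box_dia _ _ _ _ i j).
rewrite negb_exists => /forallP TF; case/negP: fq.
(* The tuple [r] over [K3] satisfies [p <= r] and [dm_conf r <= q]. *)
pose r := map_tuple (fun x => if x == dmB then dmT else x) p.
have pr : designated (f r).
  apply: designated_le fp; apply: fpos => i; rewrite tnth_map.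
  by case: (tnth p i).
have rK i : tnth r i \in K3 by rewrite tnth_map !inE; case: (tnth p i).
apply: designated_le (designated_conf_K3 _ _ _ hf fK rK pr).
apply: fpos => i; rewrite !tnth_map.
by move: (NB i) (TF i); rewrite ?inE; case: (tnth p i) (tnth q i) => [] [].
Qed.

Theorem mainTheorem1 (n : nat) (f : DMfun n) :
  (clone_gen (DLat `|` [set op_neg; op_conf]) (op f) <-> harmonious f) /\
  (clone_gen (DLat `|` [set op_conf]) (op f) <->
     harmonious f /\ positive f) /\
  (clone_gen (DLat `|` [set op_neg]) (op f) <->
     harmonious f /\ persistent f) /\
  (clone_gen (DLat `|` [set op_neg; op_box]) (op f) <->
     harmonious f /\ preserves f B2 /\ preserves f K3 /\ preserves f P3) /\
  (clone_gen (DLat `|` [set op_box; op_dia]) (op f) <->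
     harmonious f /\ positive f /\
     preserves f B2 /\ preserves f K3 /\ preserves f P3).
Proof.
have in_gen (U : set DMop) g : U g -> clone_gen (DLat `|` U) g.
  by move=> Ug; apply: sub_clone_gen; right.
(* The invariants are checked on the generators by finite case analysis. *)
have h1 : [set op_neg; op_conf] `<=` preserves_rel conf_rel.
  by move=> _ [->|->]; apply: preserves_rel_unary; do 2!case.
have h2 : [set op_conf] `<=` preserves_rel conf_rel.
  by move=> _ ->; apply: preserves_rel_unary; do 2!case.
have h3 : [set op_neg] `<=` preserves_rel conf_rel.
  by move=> _ ->; apply: preserves_rel_unary; do 2!case.
have h4 : [set op_neg; op_box] `<=` preserves_rel conf_rel.
  by move=> _ [->|->]; apply: preserves_rel_unary; do 2!case.
have h5 : [set op_box; op_dia] `<=` preserves_rel conf_rel.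
  by move=> _ [->|->]; apply: preserves_rel_unary; do 2!case.
have X4 X : X \in [:: B2; K3; P3] ->
    [set op_neg; op_box] `<=` preserves_rel (in_rel X).
  by rewrite !inE => /or3P[] /eqP-> _ [->|->]; apply: preserves_rel_unary;
    rewrite /in_rel; do 2!case; rewrite !inE.
have X5 X : X \in [:: B2; K3; P3] ->
    [set op_box; op_dia] `<=` preserves_rel (in_rel X).
  by rewrite !inE => /or3P[] /eqP-> _ [->|->]; apply: preserves_rel_unary;
    rewrite /in_rel; do 2!case; rewrite !inE.
have [B K P] : [/\ B2 \in [:: B2; K3; P3], K3 \in [:: B2; K3; P3] &
  P3 \in [:: B2; K3; P3]] by rewrite !inE !eqxx !orbT.
(* In each equivalence, the forward half propagates invariants from the generators, and the converse
   feeds the matching separation lemma into [clone_of_separated]. *)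
split; [|split; [|split; [|split]]]; split.
- exact: harmonious_gen.
- move=> hf; apply: (clone_of_separated _ _ _ (lattice_clone_gen _) _ hf).
    by move=> g; apply: harmonious_gen.
  move=> p q; apply: separated_harmonious; first exact: clone_gen_is_clone.
    by apply: in_gen; left.
  by apply: in_gen; right.
- move=> Cf; split; first exact: harmonious_gen Cf.
  apply: positive_gen Cf => _ ->.
  by apply: preserves_rel_unary; do 2!case.
- move=> [hf fpos]; apply: (clone_of_separated _ _ _ (lattice_clone_gen _) _ hf).
    by move=> g; apply: harmonious_gen.
  move=> p q; apply: separated_positive fpos; first exact: clone_gen_is_clone.
  exact: in_gen.
- move=> Cf; split; first exact: harmonious_gen Cf.
  apply: persistent_gen Cf => _ ->.
  by apply: preserves_rel_unary; do 2!case.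
- move=> [hf fper]; apply: (clone_of_separated _ _ _ (lattice_clone_gen _) _ hf).
    by move=> g; apply: harmonious_gen.
  move=> p q; apply: separated_persistent fper; first exact: clone_gen_is_clone.
  exact: in_gen.
- move=> Cf; split; first exact: harmonious_gen Cf.
  by split; [|split]; apply: preserves_gen Cf => //; apply: X4.
- move=> [hf [_ [fK _]]]; apply: (clone_of_separated _ _ _ (lattice_clone_gen _) _ hf).
    by move=> g; apply: harmonious_gen.
  move=> p q; apply: separated_neg_box hf fK; first exact: lattice_clone_gen.
    by apply: in_gen; left.
  by apply: in_gen; right.
- move=> Cf; split; first exact: harmonious_gen Cf.
  split; last by split; [|split]; apply: preserves_gen Cf => //; apply: X5.
  apply: positive_gen Cf => _ [->|->];
    by apply: preserves_rel_unary; do 2!case.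
- move=> [hf [fpos [_ [fK _]]]].
  apply: (clone_of_separated _ _ _ (lattice_clone_gen _) _ hf).
    by move=> g; apply: harmonious_gen.
  move=> p q; apply: separated_box_dia_positive hf fpos fK.
  + exact: lattice_clone_gen.
  + by apply: in_gen; left.
  + by apply: in_gen; right.
Qed.
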